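(* Let $G$ be a finite group, let $u$ be a fixed representative of a conjugacy class of $G$, let $\eta$ be an irreducible character of $C_G(u)$, and let $m\ge 1$. Then the $m$-th Frobenius-Schur indicator of the character $\chi$ of $D(G)$ induced from $\eta$ is given by $$\nu_m(\chi)=\frac{1}{|C_G(u)|}\sum_{y\in\tilde G_m^m(u)}\Gamma_m(u,y)\,\eta(y).$$
   Context: For a finite group $G$, the Drinfel'd double $D(G)$ is the semisimple Hopf algebra over $\mathbb{C}$ with basis $\{p_g\bowtie x : g,x\in G\}$, multiplication $(p_k\bowtie z)(p_h\bowtie y)=\delta_{k,zhz^{-1}}\,p_k\bowtie zy$, unit $\sum_{g\in G}p_g\bowtie 1$, comultiplication $\Delta(p_g\bowtie x)=\sum_{h\in G}(p_h\bowtie x)\otimes(p_{h^{-1}g}\bowtie x)$, counit $\epsilon(p_g\bowtie x)=\delta_{g,1}$ and antipode $S(p_g\bowtie x)=p_{x^{-1}g^{-1}x}\bowtie x^{-1}$. Put $\Lambda=\frac1{|G|}\sum_{g\in G}p_1\bowtie g$, and for $m\ge1$ let $\Lambda^{[m]}=\sum\Lambda_1\cdots\Lambda_m$ be the $m$-fold product of the iterated comultiplication of $\Lambda$ ($\Lambda^{[1]}=\Lambda$). For an irreducible character $\chi$ of $D(G)$ (trace function of a simple module), $\nu_m(\chi)=\chi(\Lambda^{[m]})$ is its $m$-th Frobenius-Schur indicator. For $u\in G$ and a simple $\mathbb{C}C_G(u)$-module $V$ with character $\eta$, the space $\hat V=\mathbb{C}G\otimes_{\mathbb{C}C_G(u)}V$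 is a simple $D(G)$-module via $(p_h\bowtie x)\cdot(y\otimes v)=\delta_{xyu(xy)^{-1},\,h}\;xy\otimes v$ for $h,x,y\in G$, $v\in V$; its character is called the character of $D(G)$ induced from $\eta$. Define $\tilde G_m(u)=\{h\in G : (uh)^m=h^m\}$; then $h^m\in C_G(u)$ for every $h\in\tilde G_m(u)$. Fix a set $\mathfrak{R}_{C_G(u)}$ of representatives of the conjugacy classes of $C_G(u)$. $\tilde G_m^m(u)$ is the set of all $y\in\mathfrak{R}_{C_G(u)}$ for which there is $h\in\tilde G_m(u)$ with $h^m$ in the $C_G(u)$-conjugacy class of $y$. For $y\in C_G(u)$, $\Gamma_m(u,y)$ is the number of $h\in G$ with $(uh)^m=h^m$ and $h^m$ in the $C_G(u)$-conjugacy class of $y$. *)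

(* Defs.v *)
From HB Require Import structures.
From mathcomp Require Import all_boot all_order all_fingroup all_algebra.
From mathcomp Require Import mxrepresentation.
From mathcomp Require Export reals complex.

Set Implicit Arguments.
Unset Strict Implicit.
Unset Printing Implicit Defensive.

Import GroupScope GRing.Theory.
Local Open Scope ring_scope.

Section FreeVectorSpace.
Variables (F : fieldType) (I : finType).

Definition basisv (i : I) : {ffun I -> F^o} := [ffun j => (j == i)%:R].

Definition linext (V : lmodType F) (phi : I -> V) (a : {ffun I -> F^o}) : V :=
  \sum_i (a i : F) *: phi i.

Lemma linext_is_linear (V : lmodType F) (phi : I -> V) : linear (linext phi).
Proof.
move=> c a b; rewrite /linext scaler_sumr -big_split /=.
by apply: eq_bigr => i _; rewrite !ffunE scalerDl scalerA.
Qed.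
HB.instance Definition _ (V : lmodType F) (phi : I -> V) :=
  GRing.isSemilinear.Build F _ _ _ (linext phi)
    (GRing.semilinear_linear (linext_is_linear phi)).

Lemma linextZ (V : lmodType F) (phi : I -> V) k a :
  linext phi (k *: a) = k *: linext phi a.
Proof. exact: linearZ. Qed.

Lemma eq_linext (V : lmodType F) (phi psi : I -> V) a :
  phi =1 psi -> linext phi a = linext psi a.
Proof. by move=> e; apply: eq_bigr => i _; rewrite e. Qed.

Lemma linext_funZ (V : lmodType F) (phi : I -> V) k a :
  linext (fun i => k *: phi i) a = k *: linext phi a.
Proof.
by rewrite /linext scaler_sumr; apply: eq_bigr => i _; rewrite !scalerA mulrC.
Qed.

Lemma linext_funD (V : lmodType F) (phi psi : I -> V) a :
  linext (fun i => phi i + psi i) a = linext phi a + linext psi a.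
Proof.
by rewrite /linext -big_split; apply: eq_bigr => i _; rewrite scalerDr.
Qed.

Lemma linext_fun_sum (V : lmodType F) (J : finType) (phi : J -> I -> V) a :
  linext (fun i => \sum_j phi j i) a = \sum_j linext (phi j) a.
Proof.
rewrite /linext exchange_big /=; apply: eq_bigr => i _.
by rewrite scaler_sumr.
Qed.

Lemma linextE (V : lmodType F) (phi : I -> V) (i : I) :
  linext phi (basisv i) = phi i.
Proof.
rewrite /linext (bigD1 i) //= ffunE eqxx scale1r big1 ?addr0 // => j ji.
by rewrite ffunE (negPf ji) scale0r.
Qed.

Lemma linext_basisv (a : {ffun I -> F^o}) : linext basisv a = a.
Proof.
apply/ffunP=> j; rewrite /linext sum_ffunE (bigD1 j) //= !ffunE eqxx big1 => [|i].
  by rewrite addr0 [LHS]mulr1.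
by rewrite !ffunE eq_sym => /negPf->; rewrite [LHS]mulr0.
Qed.

End FreeVectorSpace.

(* The vector p_g >< x is [dd F g x], i.e. the basis vector at the pair (g, x). *)
Definition drinfeld (F : fieldType) (gT : finGroupType) : Type :=
  {ffun gT * gT -> F^o}.
HB.instance Definition _ F gT := Vector.on (drinfeld F gT).

Definition dd (F : fieldType) (gT : finGroupType) (g x : gT) : drinfeld F gT :=
  basisv F (g, x).
Arguments dd F {gT} g x.

Section DrinfeldAlgebra.
Variables (F : fieldType) (gT : finGroupType).
Local Notation D := (drinfeld F gT).

Definition ddmulb (b c : gT * gT) : D :=
  if b.1 == (b.2 * c.1 * b.2^-1)%g then dd F b.1 (b.2 * c.2)%g else 0.

Definition ddmul (a b : D) : D :=
  linext (fun i => linext (fun j => ddmulb i j) b) a.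

Definition ddone : D := \sum_g dd F g 1%g.

Fact ddmulDl : left_distributive ddmul +%R.
Proof. by move=> a b c; rewrite /ddmul linearD. Qed.
Fact ddmulDr : right_distributive ddmul +%R.
Proof.
move=> a b c; rewrite /ddmul -linext_funD; apply: eq_linext => i.
exact: (linearD (linext (ddmulb i))).
Qed.
Fact ddmulZl (k : F) (a b : D) : k *: ddmul a b = ddmul (k *: a) b.
Proof. by rewrite /ddmul linearZ. Qed.
Fact ddmulZr (k : F) (a b : D) : k *: ddmul a b = ddmul a (k *: b).
Proof.
rewrite /ddmul -linext_funZ; apply: eq_linext => i.
by symmetry; apply: (linextZ (ddmulb i)).
Qed.
Fact ddmul_suml (J : finType) (f : J -> D) b :
  ddmul (\sum_j f j) b = \sum_j ddmul (f j) b.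
Proof. exact: (linear_sum (linext _)). Qed.
Fact ddmul_sumr (J : finType) (f : J -> D) a :
  ddmul a (\sum_j f j) = \sum_j ddmul a (f j).
Proof.
rewrite /ddmul -linext_fun_sum; apply: eq_linext => i.
exact: (linear_sum (linext (ddmulb i))).
Qed.

Lemma ddmulE k z h y :
  ddmul (dd F k z) (dd F h y)
  = if k == (z * h * z^-1)%g then dd F k (z * y)%g else 0.
Proof. by rewrite /ddmul !linextE. Qed.

Lemma ddE (a : D) : a = \sum_(i : gT * gT) (a i : F) *: dd F i.1 i.2.
Proof.
by rewrite -[LHS]linext_basisv /linext; apply: eq_bigr => -[].
Qed.

Fact ddmul0l a : ddmul 0 a = 0.
Proof. by rewrite -[0 in LHS](scale0r (0 : D)) -ddmulZl scale0r. Qed.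
Fact ddmul0r a : ddmul a 0 = 0.
Proof. by rewrite -[0 in LHS](scale0r (0 : D)) -ddmulZr scale0r. Qed.

Fact ddmulA : associative ddmul.
Proof.
move=> a b c; rewrite (ddE a) [LHS]ddmul_suml [ddmul _ b]ddmul_suml.
rewrite [RHS]ddmul_suml; apply: eq_bigr => -[g x] _.
rewrite -[LHS]ddmulZl -[ddmul _ b]ddmulZl -[RHS]ddmulZl; congr (_ *: _).
rewrite (ddE b) [ddmul _ c]ddmul_suml [LHS]ddmul_sumr [ddmul (dd _ _ _) _]ddmul_sumr.
rewrite [RHS]ddmul_suml; apply: eq_bigr => -[h y] _.
rewrite -[ddmul _ c in LHS]ddmulZl -[LHS]ddmulZr.
rewrite -[ddmul _ (_ *: _)]ddmulZr -[RHS]ddmulZl; congr (_ *: _).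
rewrite (ddE c) [ddmul (dd _ h y) _]ddmul_sumr [LHS]ddmul_sumr [RHS]ddmul_sumr.
apply: eq_bigr => -[k z] _.
rewrite -[ddmul (dd _ h y) _]ddmulZr -[LHS]ddmulZr -[RHS]ddmulZr.
congr (_ *: _) => /=.
rewrite !ddmulE.
have [->|n1] := eqVneq h (y * k * y^-1)%g; last first.
  rewrite ddmul0r; case: ifP => [/eqP->|_]; last by rewrite ddmul0l.
  rewrite ddmulE ifF //; apply: contraNF n1.
  by rewrite invMg !mulgA => /eqP/mulIg; rewrite -!mulgA => /mulgI->.
rewrite ddmulE; case: ifP => [/eqP->|_]; last by rewrite ddmul0l.
by rewrite ddmulE invMg !mulgA eqxx.
Qed.

Fact ddmul1l : left_id ddone ddmul.
Proof.
move=> a; rewrite (ddE a) ddmul_sumr; apply: eq_bigr => -[g x] _ /=.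
rewrite -ddmulZr; congr (_ *: _); rewrite /ddone ddmul_suml (bigD1 g) //=.
rewrite big1 => [|h /negPf hg]; rewrite ddmulE invg1 mulg1 !mul1g ?hg //.
by rewrite eqxx addr0.
Qed.

Fact ddmul1r : right_id ddone ddmul.
Proof.
move=> a; rewrite (ddE a) ddmul_suml; apply: eq_bigr => -[g x] _ /=.
rewrite -ddmulZl; congr (_ *: _); rewrite /ddone ddmul_sumr.
rewrite (bigD1 (x^-1 * g * x)%g) //= big1 => [|h /negPf hg]; rewrite ddmulE mulg1.
  by rewrite !mulgA mulgV mul1g mulgK eqxx addr0.
case: ifP => // /eqP gE; move/negbT: hg; case/negP; apply/eqP.
by rewrite gE !mulgA mulVg mul1g mulgKV.
Qed.

Fact ddone_neq0 : ddone != 0.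
Proof.
apply/eqP => /ffunP/(_ (1%g, 1%g)); rewrite /ddone sum_ffunE (bigD1 1%g) //=.
rewrite !ffunE eqxx big1 ?addr0 => [/eqP|h /negPf h1].
  by rewrite oner_eq0.
by rewrite ffunE xpair_eqE eq_sym h1.
Qed.

HB.instance Definition _ := GRing.Zmodule_isNzRing.Build (drinfeld F gT)
  ddmulA ddmul1l ddmul1r ddmulDl ddmulDr ddone_neq0.
HB.instance Definition _ := GRing.Lmodule_isLalgebra.Build F (drinfeld F gT)
  ddmulZl.
HB.instance Definition _ := GRing.Lalgebra_isAlgebra.Build F (drinfeld F gT)
  ddmulZr.

End DrinfeldAlgebra.

Section SweedlerPowers.
Variables (F : fieldType) (gT : finGroupType).
Local Notation D := (drinfeld F gT).

(* As D is free on gT * gT, its tensor square and its m-th tensor power are    *)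
(* the free vector spaces on pairs and on m-tuples of basis indices.           *)
Definition ddtens2 : Type := {ffun (gT * gT) * (gT * gT) -> F^o}.
HB.instance Definition _ := Vector.on ddtens2.
Definition ddtens (m : nat) : Type := {ffun m.-tuple (gT * gT) -> F^o}.
HB.instance Definition _ m := Vector.on (ddtens m).

Definition tens2 (a b : D) : ddtens2 :=
  [ffun ij => (a ij.1 : F) * (b ij.2 : F)].

Definition tens_cons m (a : D) (w : ddtens m) : ddtens m.+1 :=
  [ffun t : m.+1.-tuple (gT * gT) =>
     (a (thead t) : F) * (w (behead_tuple t) : F)].

Definition comul : D -> ddtens2 :=
  linext (fun gx : gT * gT =>
    \sum_h tens2 (dd F h gx.2) (dd F (h^-1 * gx.1)%g gx.2)).

Definition counit : D -> F^o :=
  linext (fun gx : gT * gT => ((gx.1 == 1%g)%:R : F^o)).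

(* Iterated comultiplication D -> D^{(x) m}:                                   *)
(* Delta^(0) = epsilon and Delta^(m+1) = (id (x) Delta^(m)) o Delta.           *)
Fixpoint itcomul (m : nat) : D -> ddtens m :=
  match m with
  | 0 => fun a => [ffun=> counit a]
  | m'.+1 => fun a =>
      linext (fun ij : (gT * gT) * (gT * gT) =>
                tens_cons (dd F ij.1.1 ij.1.2) (itcomul m' (dd F ij.2.1 ij.2.2)))
             (comul a)
  end.

Definition itmul (m : nat) : ddtens m -> D :=
  linext (fun t : m.-tuple (gT * gT) => \prod_(i <- t) dd F i.1 i.2).

Definition ddLambda : D := (#|gT|%:R)^-1 *: \sum_g dd F 1%g g.

Definition ddLambda_pow (m : nat) : D := itmul (itcomul m ddLambda).

Definition FSindicator (m : nat) (chi : D -> F) : F := chi (ddLambda_pow m).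

Lemma tens2_dd (i j : gT * gT) :
  tens2 (dd F i.1 i.2) (dd F j.1 j.2) = basisv F (i, j).
Proof.
apply/ffunP=> -[k l]; rewrite !ffunE /= -!surjective_pairing xpair_eqE.
by rewrite -[LHS]natrM mulnb.
Qed.

Lemma comul_dd (g x : gT) :
  comul (dd F g x) = \sum_h tens2 (dd F h x) (dd F (h^-1 * g)%g x).
Proof. exact: linextE. Qed.

Lemma counit_dd (g x : gT) : counit (dd F g x) = (g == 1%g)%:R.
Proof. exact: linextE. Qed.

Lemma itmul_itcomul1 (a : D) : itmul (itcomul 1 a) = a.
Proof.
have it1 g x : itcomul 1 (dd F g x) =
    \sum_h tens_cons (dd F h x) ([ffun=> (h^-1 * g == 1)%g%:R] : ddtens 0).
  rewrite /itcomul comul_dd linear_sum; apply: eq_bigr => h _.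
  rewrite (tens2_dd (_, _) (_, _)) [LHS]linextE; congr (tens_cons _ _).
  by apply/ffunP=> t; rewrite !ffunE; apply: counit_dd.
have dd1 g x : itmul (itcomul 1 (dd F g x)) = dd F g x.
  rewrite it1 /itmul linear_sum (bigD1 g) //= big1 ?addr0 => [|h hg].
    rewrite [X in linext _ X](_ : _ = basisv F [tuple (g, x)]).
      by rewrite linextE big_seq1.
    apply/ffunP=> t; case/tupleP: t => i t; rewrite (tuple0 t) !ffunE theadE.
    by rewrite mulVg eqxx [LHS]mulr1 -val_eqE /= eqseq_cons andbT.
  rewrite [X in linext _ X](_ : _ = 0) ?linear0 //.
  by apply/ffunP=> t; rewrite !ffunE -eq_mulVg1 (negPf hg) [LHS]mulr0.
have itZ k (b : D) : itmul (itcomul 1 (k *: b)) = k *: itmul (itcomul 1 b).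
  transitivity (itmul (k *: itcomul 1 b)); last exact: linextZ.
  congr itmul; rewrite /itcomul.
  have -> : comul (k *: b) = k *: comul b by exact: linextZ.
  exact: linextZ.
have itS (f : gT * gT -> D) :
    itmul (itcomul 1 (\sum_i f i)) = \sum_i itmul (itcomul 1 (f i)).
  transitivity (itmul (\sum_i itcomul 1 (f i))).
    congr itmul; rewrite /itcomul.
    have -> : comul (\sum_i f i) = \sum_i comul (f i).
      exact: (linear_sum (linext _)).
    exact: (linear_sum (linext _)).
  exact: (linear_sum (linext _)).
rewrite [RHS]ddE {1}(ddE a) itS; apply: eq_bigr => i _.
by rewrite itZ dd1.
Qed.

Lemma ddLambda_pow1 : ddLambda_pow 1 = ddLambda.
Proof. exact: itmul_itcomul1. Qed.

End SweedlerPowers.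

Section Modules.
Variable F : fieldType.

Record algModule (A : algType F) := AlgModule {
  modspace : vectType F;
  modact : A -> 'End(modspace);
  _ : linear modact;
  _ : modact 1 = \1%VF;
  _ : forall a b, modact (a * b) = (modact a \o modact b)%VF
}.

Definition lftrace (W : vectType F) (f : 'End(W)) : F :=
  \tr (passmx.mxof (vbasis {:W}) (vbasis {:W}) f).

Definition modchar (A : algType F) (W : algModule A) (a : A) : F :=
  lftrace (modact W a).

End Modules.

(* The quotient W / K is realised on the complement K^C of K, through the      *)
(* projection [quotpi K] with kernel K.                                        *)
Section Quotient.
Variables (F : fieldType) (W : vectType F) (K : {vspace W}).

Definition quotv : vectType F := subvs_of (K^C)%VS.

Definition quotpi : 'Hom(W, quotv) :=
  (linfun (vsproj (K^C)%VS) \o daddv_pi (K^C)%VS K)%VF.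

Definition quotmap (f : 'End(W)) : 'End(quotv) :=
  (quotpi \o f \o linfun (@vsval _ _ (K^C)%VS))%VF.

Let capK : (K^C :&: K = 0)%VS.
Proof. by rewrite capvC capv_compl. Qed.

Lemma quotpi_val (w : quotv) : quotpi (vsval w) = w.
Proof.
rewrite comp_lfunE lfunE /= daddv_pi_id ?subvsP //; exact: vsvalK.
Qed.

Lemma limg_quotpi : limg quotpi = fullv.
Proof.
apply/eqP; rewrite eqEsubv subvf; apply/subvP=> w _.
by rewrite -(quotpi_val w) memv_img ?memvf.
Qed.

Lemma lker_quotpi : lker quotpi = K.
Proof.
apply/vspaceP=> w; rewrite memv_ker comp_lfunE lfunE /=.
have wE : daddv_pi (K^C) K w + daddv_pi K (K^C) w = w.
  by apply: daddv_pi_add; rewrite // addvC addv_complf memvf.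
have piC := memv_pi (K^C)%VS K w.
apply/eqP/idP => [/(congr1 vsval)|wK].
  rewrite vsprojK // linear0 => pi0.
  by rewrite -wE pi0 add0r memv_pi.
have : daddv_pi (K^C) K w \in (K^C :&: K)%VS.
  rewrite memv_cap piC /= -(addrK (daddv_pi K (K^C) w) (daddv_pi _ _ _)) wE.
  by rewrite memvB ?memv_pi.
by rewrite capK memv0 => /eqP->; rewrite linear0.
Qed.

Lemma quotmapE (f : 'End(W)) :
  (f @: K <= K)%VS -> forall w, quotmap f (quotpi w) = quotpi (f w).
Proof.
move=> fK w.
have -> : quotmap f (quotpi w) = quotpi (f (vsval (quotpi w))).
  by rewrite /quotmap comp_lfunE comp_lfunE [linfun _ (quotpi w)]lfunE.
apply/eqP; rewrite -subr_eq0 -linearB -linearB -memv_ker lker_quotpi.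
apply: (subvP fK); apply: memv_img.
have -> : (vsval (quotpi w) - w \in K) = (vsval (quotpi w) - w \in lker quotpi).
  by rewrite lker_quotpi.
by rewrite memv_ker linearB /= quotpi_val subrr.
Qed.

End Quotient.

Section InducedModule.
Variables (F : fieldType) (gT : finGroupType) (u : gT) (n : nat).
Variable rV : mx_representation F 'C[u]%g n.
Local Notation D := (drinfeld F gT).

(* V is 'cV[F]_n with c . v = rV c *m v, a left module as rV (c d) = rV c *m   *)
(* rV d.  F[G] (x)_F V is the space of functions G -> V, with y (x) v the      *)
(* function supported at y with value v.                                       *)
Definition preind : vectType F := {ffun gT -> 'cV[F]_n}.

Definition pretens (y : gT) (v : 'cV[F]_n) : preind :=
  [ffun z => if z == y then v else 0].

Definition balrel (y c : gT) (v : 'cV[F]_n) : preind :=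
  pretens (y * c)%g v - pretens y (rV c *m v).

Definition balanced : {vspace preind} :=
  (\sum_(y : gT) \sum_(c in 'C[u]%g) limg (linfun (balrel y c)))%VS.

Definition indspace : vectType F := quotv balanced.

Definition indtens (y : gT) (v : 'cV[F]_n) : indspace :=
  quotpi balanced (pretens y v).

Definition preact (h x : gT) (f : preind) : preind :=
  \sum_y ((x * y * u * (x * y)^-1)%g == h)%:R *: pretens (x * y)%g (f y).

Definition indact : D -> 'End(indspace) :=
  linext (fun hx : gT * gT => quotmap balanced (linfun (preact hx.1 hx.2))).

Lemma pretens_is_linear y : linear (pretens y).
Proof.
by move=> k v w; apply/ffunP=> z; rewrite !ffunE; case: eqP;
   rewrite // scaler0 addr0.
Qed.
HB.instance Definition _ y := GRing.isSemilinear.Build F _ _ _ (pretens y)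
  (GRing.semilinear_linear (pretens_is_linear y)).

Lemma balrel_is_linear y c : linear (balrel y c).
Proof.
move=> k v w; rewrite /balrel mulmxDr -scalemxAr !(linearP (pretens _)) scalerBr.
by rewrite opprD addrACA.
Qed.
HB.instance Definition _ y c := GRing.isSemilinear.Build F _ _ _ (balrel y c)
  (GRing.semilinear_linear (balrel_is_linear y c)).

Lemma preact_is_linear h x : linear (preact h x).
Proof.
move=> k f g; rewrite /preact scaler_sumr -big_split; apply: eq_bigr => y _ /=.
by rewrite !ffunE linearP scalerDr !scalerA mulrC.
Qed.
HB.instance Definition _ h x := GRing.isSemilinear.Build F _ _ _ (preact h x)
  (GRing.semilinear_linear (preact_is_linear h x)).

Lemma preact_tens h x y v :
  preact h x (pretens y v)
  = ((x * y * u * (x * y)^-1)%g == h)%:R *: pretens (x * y)%g v.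
Proof.
rewrite /preact (bigD1 y) //= ffunE eqxx big1 ?addr0 // => z /negPf zy.
by rewrite ffunE zy linear0 scaler0.
Qed.

Lemma preind_sum (f : preind) : f = \sum_y pretens y (f y).
Proof.
apply/ffunP=> z; rewrite sum_ffunE (bigD1 z) //= ffunE eqxx big1 ?addr0 //.
by move=> y /negPf yz; rewrite ffunE eq_sym yz.
Qed.

Lemma preact_balanced h x :
  (linfun (preact h x) @: balanced <= balanced)%VS.
Proof.
rewrite limg_sum; apply/subv_sumP=> y _; rewrite limg_sum.
apply/subv_sumP=> c cC; apply/subvP=> _ /memv_imgP[_ /memv_imgP[v _ ->] ->].
rewrite !lfunE /= /balrel linearB /= !preact_tens mulgA.
have -> : (x * y * c * u * (x * y * c)^-1 = x * y * u * (x * y)^-1)%g.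
  rewrite invMg !mulgA -(mulgA (x * y)%g c u) (cent1P cC) !mulgA.
  by rewrite mulgK.
rewrite -scalerBr memvZ // -[_ - _]/(balrel (x * y)%g c v).
apply: (subvP (sumv_sup (x * y)%g _ (sumv_sup c cC (subvv _)))) => //.
by rewrite -[balrel _ _ _]lfunE memv_img ?memvf.
Qed.

Lemma indtensM y c v : c \in 'C[u]%g -> indtens (y * c)%g v = indtens y (rV c *m v).
Proof.
move=> cC; apply/eqP; rewrite -subr_eq0 -linearB /= -memv_ker lker_quotpi.
rewrite -[_ - _]/(balrel y c v).
apply: (subvP (sumv_sup y _ (sumv_sup c cC (subvv _)))) => //.
by rewrite -[balrel _ _ _]lfunE memv_img ?memvf.
Qed.

Lemma indact_tens h x y v :
  indact (dd F h x) (indtens y v)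
  = ((x * y * u * (x * y)^-1)%g == h)%:R *: indtens (x * y)%g v.
Proof.
rewrite /indact linextE /indtens quotmapE ?preact_balanced //.
by rewrite [linfun (preact _ _) _]lfunE /= preact_tens linearZ.
Qed.

Lemma ind_ext (f g : 'End(indspace)) :
  (forall y v, f (indtens y v) = g (indtens y v)) -> f = g.
Proof.
move=> fg; apply/lfunP=> w; rewrite -(quotpi_val w) (preind_sum (vsval w)).
by rewrite !linear_sum; apply: eq_bigr => y _; apply: fg.
Qed.

Fact indact_linear : linear indact.
Proof. exact: linext_is_linear. Qed.

Fact indact1 : indact 1 = \1%VF.
Proof.
apply: ind_ext => y v; rewrite id_lfunE.
rewrite -[1]/(ddone F gT) /ddone /indact linear_sum sum_lfunE.
rewrite (bigD1 (y * u * y^-1)%g) //= -/indact indact_tens !mul1g eqxx scale1r.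
rewrite big1 ?addr0 // => g /negPf gy.
by rewrite -/indact indact_tens !mul1g eq_sym gy scale0r.
Qed.

Fact indactM_basis k z h x y v :
  indact (dd F k z * dd F h x) (indtens y v)
  = indact (dd F k z) (indact (dd F h x) (indtens y v)).
Proof.
rewrite -[_ * _]/(ddmul _ _) ddmulE indact_tens linearZ /= indact_tens.
have -> : (z * (x * y) * u * (z * (x * y))^-1
           = z * (x * y * u * (x * y)^-1) * z^-1)%g by rewrite !invMg !mulgA.
have [<-|nh] := eqVneq (x * y * u * (x * y)^-1)%g h; last first.
  rewrite scale0r; case: ifP => [/eqP kE|_]; last first.
    by rewrite /indact linear0 lfunE.
  rewrite indact_tens; case: eqP => [E|_]; last by rewrite scale0r.
  case/eqP: nh; apply: (mulgI z); apply: (mulIg z^-1%g).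
  by rewrite -kE -E !invMg !mulgA.
rewrite scale1r eq_sym; case: ifP => [/eqP <-|_].
  rewrite indact_tens; set s := (_ == _); have -> : s = true.
    by apply/eqP; rewrite !invMg !mulgA.
  by rewrite -mulgA.
by rewrite scale0r /indact linear0 lfunE.
Qed.

Fact indactM a b : indact (a * b) = (indact a \o indact b)%VF.
Proof.
apply: ind_ext => y v; rewrite comp_lfunE.
have actE c w : indact c w = \sum_i (c i : F) *: indact (dd F i.1 i.2) w.
  rewrite {1}(ddE c) {1}/indact linear_sum sum_lfunE; apply: eq_bigr => i _.
  by rewrite linearZ scale_lfunE.
have mulE : a * b = \sum_i \sum_j ((a i : F) * (b j : F)) *:
     (dd F i.1 i.2 * dd F j.1 j.2).
  rewrite {1}(ddE a) mulr_suml; apply: eq_bigr => i _.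
  rewrite {1}(ddE b) mulr_sumr; apply: eq_bigr => j _.
  by rewrite -scalerAl -scalerAr scalerA.
rewrite mulE {1}/indact linear_sum sum_lfunE (actE a); apply: eq_bigr => i _.
rewrite linear_sum sum_lfunE (actE b) linear_sum scaler_sumr.
apply: eq_bigr => j _; rewrite linearZ scale_lfunE linearZ scalerA.
by congr (_ *: _); apply: indactM_basis.
Qed.

Definition induced_module : algModule (drinfeld F gT) :=
  AlgModule indact_linear indact1 indactM.

End InducedModule.

Section GTm.
Variables (gT : finGroupType).

Definition Gtilde (m : nat) (u : gT) : {set gT} :=
  [set h | ((u * h) ^+ m == h ^+ m)%g].

Definition Gtilde_pow (m : nat) (u : gT) (reps : {set gT}) : {set gT} :=
  [set y in reps | [exists h in Gtilde m u, (h ^+ m)%g \in (y ^: 'C[u])%g]].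

Definition Gamma (m : nat) (u y : gT) : nat :=
  #|[set h : gT | ((u * h) ^+ m == h ^+ m)%g
                  & (h ^+ m)%g \in (y ^: 'C[u])%g]|.

End GTm.

(* Main.v *)
From HB Require Import structures.
Require Import Defs.
From mathcomp Require Import all_boot all_order all_fingroup all_algebra.
From mathcomp Require Import mxrepresentation reals complex.
Local Open Scope ring_scope.

Set Implicit Arguments.
Unset Strict Implicit.
Unset Printing Implicit Defensive.
Import GroupScope GRing.Theory Num.Theory passmx.
Local Open Scope ring_scope.

(** The integral is an average of the elements [p_1 >< x], and expanding its
    [m]-th Sweedler power ([sweedler_pow_dd]) gives
      [Lambda^[m] = 1/|G| sum_x sum_k p_k >< x^m],
    over the [k] with [(k x^-1)^m x^m = 1]. The character of the induced module is
    the familiar one ([modchar_induced_dd]): it is computed from the tensors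
    [y (x) e_j], which span but are not independent, with coefficients obtained by
    averaging over the centralizer [C] of [u]. Its value at [p_k >< x^m] is
      [1/|C| sum_y eta(y^-1 x^m y)],
    over the [y] in [G] with [k = y u y^-1] and [y^-1 x^m y] in [C].
    Substituting [x = y h^-1 y^-1] turns the condition into [(u h)^m = h^m], so
    that the indicator is [1/|C|] times the sum of [eta(h^-m)] over the solutions
    [h] of this equation.

    The formula to be proved has [eta(h^m)] in place of [eta(h^-m)]. The map
    [h |-> (u h)^-1] permutes the solutions and replaces [h^m] by its inverse
    ([sum_Gtilde_inv]), so the two sums agree. Since [eta] is a class function on
    [C], it remains to collect the [h] according to the class of [h^m]
    ([sum_Gtilde_classes]). *)

(** * Sweedler powers in the Drinfel'd double *)

Section SweedlerPower.
Variables (F : fieldType) (gT : finGroupType).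
Local Notation D := (drinfeld F gT).

(** The linear map [a |-> a_1 * ... * a_m], whose value at the integral is
    [ddLambda_pow]. *)
Definition sweedler_pow m (a : D) : D := itmul (itcomul m a).

(** Multiplication of an [m.+1]-tensor splits off its first factor; this turns
    the recursive definition of the iterated comultiplication into a recursion
    for [sweedler_pow]. *)
Lemma itmul_cons m (a : D) (w : ddtens F gT m) :
  itmul (tens_cons a w) = a * itmul w :> D.
Proof.
transitivity (\sum_i \sum_(t : m.-tuple (gT * gT))
    ((a i : F) * (w t : F)) *: (dd F i.1 i.2 * \prod_(j <- t) dd F j.1 j.2)).
  rewrite /itmul /linext pair_big /=.
  rewrite (reindex (fun p : (gT * gT) * m.-tuple (gT * gT) => cons_tuple p.1 p.2)) /=.
    apply: eq_bigr => -[i t] _ /=; rewrite ffunE theadE big_cons.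
    by congr (((a i : F) * (w _ : F)) *: _); apply: val_inj.
  exists (fun t => (thead t, behead_tuple t)) => [[i t] _ | t _] /=.
    by rewrite theadE; congr (_, _); apply: val_inj.
  by case/tupleP: t => i t; apply: val_inj; rewrite /= theadE.
rewrite {2}(ddE a) mulr_suml; apply: eq_bigr => i _.
rewrite /itmul /linext mulr_sumr; apply: eq_bigr => t _.
by rewrite -scalerAl -scalerAr scalerA.
Qed.

Lemma sweedler_powS m (g x : gT) :
  sweedler_pow m.+1 (dd F g x) =
  \sum_h dd F h x * sweedler_pow m (dd F (h^-1 * g)%g x).
Proof.
rewrite /sweedler_pow [itcomul _ _]/= comul_dd linear_sum /= [LHS]linear_sum.
apply: eq_bigr => h _.
by rewrite (tens2_dd _ (h, x) (_, x)) linextE /=; apply: itmul_cons.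
Qed.

(** The product of [p_(h_1) >< x, ..., p_(h_m) >< x] vanishes unless each
    [h_(i+1)] is [h_i ^ x], so a nonzero term is determined by [k = h_1]. The
    condition [h_1 * ... * h_m = g] then reads [k * k ^ x * k ^ (x ^+ 2) * ... = g],
    and the left-hand side telescopes to [(k * x^-1) ^+ m * x ^+ m]. *)
Lemma sweedler_pow_dd m (g x : gT) :
  sweedler_pow m (dd F g x) =
  \sum_(k | ((k * x^-1) ^+ m * x ^+ m)%g == g) dd F k (x ^+ m)%g.
Proof.
elim: m g => [|m IHm] g.
  rewrite /sweedler_pow /itmul /linext (bigD1 ([tuple] : 0.-tuple (gT * gT))) //=.
  rewrite [X in _ + X]big1 => [|t]; last by move/eqP; case; apply: tuple0.
  rewrite addr0 big_nil ffunE counit_dd.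
  under [RHS]eq_bigl => k do rewrite !expg0 mulg1 eq_sym.
  have [_ | _] := eqVneq g 1%g; first by rewrite scale1r.
  by rewrite scale0r big_pred0.
rewrite sweedler_powS [RHS]big_mkcond; apply: eq_bigr => h _ /=.
(* Only [k = h ^ x] can follow the first factor [p_h >< x]. *)
rewrite IHm mulr_sumr big_mkcond (bigD1 (h ^ x)%g) //= big1 ?addr0; last first.
  move=> k kh; case: ifP => // _; rewrite -[_ * _]/(ddmul _ _) ddmulE ifF //.
  apply: contraNF kh => /eqP->.
  by rewrite conjgE !mulgA mulVg mul1g mulgKV.
rewrite -[_ * _ in LHS]/(ddmul _ _) ddmulE conjgE !mulgA mulgV mul1g !mulgK eqxx.
rewrite -expgS.
have -> : ((h * x^-1) ^+ m.+1 * x ^+ m.+1 = h * ((x^-1 * h) ^+ m * x ^+ m))%g.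
  rewrite expgSr expgS !mulgA mulgKV.
  have -> : (h * x^-1 = (x^-1 * h) ^ h^-1)%g by rewrite conjgE invgK !mulgA mulgK.
  by rewrite -conjXg conjgE invgK !mulgA mulgKV.
by rewrite (can2_eq (mulKg h) (mulKVg h)).
Qed.

Lemma sweedler_pow_is_linear m : linear (sweedler_pow m).
Proof.
move=> k a b; rewrite -[RHS](linearP (@itmul F gT m)) /sweedler_pow.
congr itmul; case: m => [|m] /=; last by rewrite /comul !linearP.
by apply/ffunP=> t; rewrite !ffunE /counit linearP.
Qed.
HB.instance Definition _ m := GRing.isSemilinear.Build F _ _ _ (sweedler_pow m)
  (GRing.semilinear_linear (sweedler_pow_is_linear m)).

Lemma ddLambda_powE m :
  ddLambda_pow F gT m = (#|gT|%:R)^-1 *: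
    \sum_x \sum_(k | ((k * x^-1) ^+ m * x ^+ m)%g == 1%g) dd F k (x ^+ m)%g.
Proof.
rewrite -[LHS]/(sweedler_pow m _) /ddLambda linearZ linear_sum; congr (_ *: _).
by apply: eq_bigr => x _; apply: sweedler_pow_dd.
Qed.

End SweedlerPower.

(** * Traces over a spanning family *)

Section Trace.
Variables (F : fieldType) (W : vectType F).

(** Here [e] need not be a basis: a spanning family with coefficient functions
    [phi] suffices, because tr(f) = sum_i tr(w |-> phi_i(w) f(e_i)) and a rank
    one map w |-> phi(w) v has trace phi(v). This is what makes the trace on a
    quotient computable without choosing a basis of the quotient. *)
Lemma lftrace_dual (I : finType) (e : I -> W) (phi : I -> W -> F)
    (f : 'End(W)) :
    (forall i, linear (phi i : W -> F^o)) ->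
    (forall w, w = \sum_i phi i w *: e i) ->
  lftrace f = \sum_i phi i (f (e i)).
Proof.
move=> phi_lin dec; rewrite /lftrace /mxtrace.
pose b := vbasis {:W}.
have phiS i (J : finType) (c : J -> F) (w : J -> W) :
    phi i (\sum_j c j *: w j) = \sum_j c j * phi i (w j).
  pose L := GRing.isSemilinear.Build F _ _ _ (phi i : W -> F^o)
    (GRing.semilinear_linear (phi_lin i)).
  pose phiL : {linear W -> F^o} := HB.pack (phi i : W -> F^o) L.
  rewrite -[phi i]/(phiL : _ -> _) linear_sum.
  by apply: eq_bigr => j _; rewrite linearZ.
transitivity (\sum_(k < \dim {:W}) \sum_i phi i b`_k * coord b k (f (e i))).
  apply: eq_bigr => k _; rewrite !mxE /= vecof_delta {1}(dec b`_k) !linear_sum.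
  by apply: eq_bigr => i _; rewrite !linearZ.
rewrite exchange_big; apply: eq_bigr => i _ /=.
rewrite [in RHS](coord_vbasis (memvf (f (e i)))) phiS.
by apply: eq_bigr => k _; rewrite mulrC.
Qed.

End Trace.

(** * The character of the induced module *)

Section InducedCharacter.
Variables (F : fieldType) (gT : finGroupType) (u : gT) (n : nat).
Variable V : mx_representation F 'C[u]%g n.
Hypothesis C_neq0 : #|'C[u]%g|%:R != 0 :> F.
Local Notation W := (preind F gT n).

(** This is the projector of F[G] (x) V onto the invariants of the action of the
    centralizer by [y (x) v |-> y * c^-1 (x) c v]. Its kernel is exactly
    [balanced V], so it gives canonical representatives of the vectors of the
    induced module. *)
Definition average (w : W) : W :=
  [ffun z => (#|'C[u]%g|%:R)^-1 *: \sum_(c in 'C[u]%g) V c *m w (z * c)%g].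

Lemma average_is_linear : linear average.
Proof.
move=> k v w; apply/ffunP=> z; rewrite !ffunE scalerA [k * _]mulrC -scalerA.
rewrite -scalerDr; congr (_ *: _); rewrite scaler_sumr -big_split.
by apply: eq_bigr => c _; rewrite !ffunE mulmxDr -scalemxAr.
Qed.
HB.instance Definition _ := GRing.isSemilinear.Build F _ _ _ average
  (GRing.semilinear_linear average_is_linear).

Lemma average_pretens y v z :
  average (pretens y v) z =
  if (z^-1 * y)%g \in 'C[u]%g
  then (#|'C[u]%g|%:R)^-1 *: (V (z^-1 * y)%g *m v) else 0.
Proof.
rewrite ffunE; case: ifP => zy.
  congr (_ *: _); rewrite (bigD1 (z^-1 * y)%g) //= ffunE mulKVg eqxx.
  rewrite big1 ?addr0 // => c /andP[_ cy]; rewrite ffunE ifF ?mulmx0 //.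
  by apply: contraNF cy => /eqP <-; rewrite mulKg.
rewrite big1 ?scaler0 // => c cC; rewrite ffunE ifF ?mulmx0 //.
by apply/eqP=> zcy; rewrite -zcy mulKg cC in zy.
Qed.

Lemma average_balanced w : w \in balanced V -> average w = 0.
Proof.
suff sub : (balanced V <= lker (linfun average))%VS.
  by move/(subvP sub); rewrite memv_ker lfunE => /eqP.
apply/subv_sumP=> y _; apply/subv_sumP=> c cC.
apply/subvP=> _ /memv_imgP[v _ ->]; rewrite memv_ker !lfunE /= /balrel linearB.
rewrite subr_eq0; apply/eqP/ffunP=> z; rewrite !average_pretens mulgA groupMr //.
by case: ifP => // zyC; rewrite repr_mxM // mulmxA.
Qed.

Lemma quotpi_average w : quotpi (balanced V) (average w) = quotpi (balanced V) w.
Proof.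
rewrite (preind_sum w) !linear_sum /=; apply: eq_bigr => y _; move: (w y) => v.
have -> : average (pretens y v) =
    (#|'C[u]%g|%:R)^-1 *: \sum_(c in 'C[u]%g) pretens (y * c^-1)%g (V c *m v).
  apply/ffunP=> z; rewrite !ffunE sum_ffunE; congr (_ *: _).
  apply: eq_bigr => c _; rewrite !ffunE -(can2_eq (mulgK c) (mulgKV c)).
  by case: ifP => //; rewrite mulmx0.
rewrite linearZ linear_sum /= (eq_bigr (fun=> indtens V y v)) => [|c cC].
  by rewrite sumr_const -scaler_nat scalerA mulVf // scale1r.
by rewrite -[LHS]indtensM // mulgKV.
Qed.

Lemma average_val_quotpi w : average (vsval (quotpi (balanced V) w)) = average w.
Proof.
have dK : vsval (quotpi (balanced V) w) - w \in lker (quotpi (balanced V)).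
  by rewrite memv_ker linearB /= quotpi_val subrr.
apply/eqP; rewrite -subr_eq0 -linearB; apply/eqP/average_balanced.
by rewrite lker_quotpi in dK.
Qed.

(** The tensors [y (x) e_j] span the induced module with redundancy, and the
    entries of the averaged representative of a vector serve as its coefficients
    on them. *)
Lemma lftrace_indspace (f : 'End(indspace V)) :
  lftrace f = \sum_(yj : gT * 'I_n)
    average (vsval (f (indtens V yj.1 (delta_mx yj.2 0)))) yj.1 yj.2 0.
Proof.
apply: (lftrace_dual (e := fun yj => indtens V yj.1 (delta_mx yj.2 0))
  (phi := fun yj w => average (vsval w) yj.1 yj.2 0)).
  by move=> [y j] k v w /=; rewrite !linearP /= !ffunE !mxE.
move=> w; rewrite -{1}(quotpi_val w) -quotpi_average.
rewrite {1}(preind_sum (average _)) linear_sum.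
rewrite -(pair_bigA _ (fun y j => average (vsval w) y j 0 *:
  indtens V y (delta_mx j 0))) /=.
apply: eq_bigr => y _.
rewrite {1}(matrix_sum_delta (average (vsval w) y)) linear_sum linear_sum.
by apply: eq_bigr => j _; rewrite big_ord1 !linearZ.
Qed.

(** [p_h >< x] sends the summand [y (x) V] to [x y (x) V] or kills it. The target
    is the same summand exactly when [x ^ y] centralizes [u]; the action there is
    that of [x ^ y] on [V], and it survives the projection [p_h] if and only if
    [h = u ^ y^-1].
    Each left coset of the centralizer is counted once per element, whence the
    factor in front. *)
Lemma modchar_induced_dd h x :
  modchar (induced_module V) (dd F h x) =
  (#|'C[u]%g|%:R)^-1 * \sum_(y | (h == u ^ y^-1)%g && (x ^ y \in 'C[u])%g)
    \tr (V (x ^ y)%g).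
Proof.
rewrite /modchar lftrace_indspace -(pair_bigA _ (fun y j =>
  average (vsval (indact V (dd F h x) (indtens V y (delta_mx j 0)))) y j 0)) /=.
rewrite mulr_sumr big_mkcond [RHS]big_mkcond; apply: eq_bigr => y _ /=.
transitivity (\sum_j (((x * y * u * (x * y)^-1)%g == h)%:R : F) *
    average (pretens (x * y)%g (delta_mx j 0)) y j 0).
  apply: eq_bigr => j _; rewrite indact_tens !linearZ /= average_val_quotpi.
  by rewrite !ffunE !mxE.
have [xyC | xyC] := boolP (x ^ y \in 'C[u])%g; last first.
  rewrite andbF big1 // => j _; rewrite average_pretens -conjgE.
  by rewrite (negPf xyC) mxE mulr0.
(* [x * y] and [y] lie in the same coset of the centralizer of [u]. *)
have -> : (x * y * u * (x * y)^-1 = u ^ y^-1)%g.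
  have -> : (x * y = y * x ^ y)%g by rewrite -conjgC.
  move: (x ^ y)%g xyC => c /cent1P cu.
  by rewrite conjgE invgK invMg !mulgA -(mulgA y) cu !mulgA mulgK.
rewrite andbT eq_sym; case: ifP => _; last first.
  by rewrite big1 // => j _; rewrite mul0r.
rewrite /mxtrace mulr_sumr; apply: eq_bigr => j _.
rewrite mul1r average_pretens -conjgE xyC mxE; congr (_ * _).
by rewrite -colE mxE.
Qed.

End InducedCharacter.

(** * Solutions of (u h)^m = h^m *)

Section Counting.
Variables (gT : finGroupType) (m : nat) (u : gT).

(** The common value [(u * h) ^+ m = h ^+ m] commutes with both [u * h] and
    [h]. *)
Lemma Gtilde_expg_cent h : h \in Gtilde m u -> (h ^+ m \in 'C[u])%g.
Proof.
rewrite inE => /eqP uhm; rewrite cent1C.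
have hC : h \in 'C[h ^+ m]%g by apply/cent1P/commuteX.
rewrite -(groupMr u hC); apply/cent1P; rewrite -uhm.
exact/commuteX.
Qed.

(** With [k = (u * h)^-1] one has [u * k = h^-1 ^ u^-1], whose [m]-th power is
    [h ^- m] because [h ^+ m] commutes with [u]. *)
Lemma Gtilde_inv_mul h :
  h \in Gtilde m u ->
  ((u * h)^-1 \in Gtilde m u)%g /\ ((u * h)^-1 ^+ m = h ^- m)%g.
Proof.
move=> hG; have /cent1P hmu := Gtilde_expg_cent hG; move: hG.
rewrite inE => /eqP uhm; have E : ((u * h)^-1 ^+ m = h ^- m)%g.
  by rewrite expgVn uhm.
split=> //; rewrite inE E invMg.
have -> : (u * (h^-1 * u^-1) = h^-1 ^ u^-1)%g by rewrite conjgE invgK.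
rewrite -conjXg expgVn; apply/eqP/conjg_fixP/commgP/commute_sym.
by apply/commuteV/commute_sym/commuteV.
Qed.

(** The injection [h |-> (u * h)^-1] of the solution set into itself inverts the
    [m]-th power, whereas [h |-> h^-1] leads to solutions for [u^-1]. *)
Lemma sum_Gtilde_inv (F : fieldType) (f : gT -> F) :
  \sum_(h in Gtilde m u) f (h ^- m)%g = \sum_(h in Gtilde m u) f (h ^+ m)%g.
Proof.
have inj_k : injective (fun h => (u * h)^-1)%g by move=> h k /invg_inj/mulgI.
have kG : [set (u * h)^-1%g | h in Gtilde m u] = Gtilde m u.
  apply/eqP; rewrite eqEcard card_imset // leqnn andbT.
  by apply/subsetP=> _ /imsetP[h /Gtilde_inv_mul[kh _] ->].
rewrite -[in RHS]kG big_imset /= => [|h k _ _]; last exact: inj_k.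
by apply: eq_bigr => h /Gtilde_inv_mul[_ ->].
Qed.

End Counting.

(** The solutions [h] are grouped by the representative of the class of [h ^+ m]
    in the centralizer; [Gamma] counts them, and [f] is constant on each group. *)
Lemma sum_Gtilde_classes (F : fieldType) (gT : finGroupType) (m : nat) (u : gT)
    (reps : {set gT}) (f : gT -> F) :
    is_transversal reps (classes 'C[u]%g) 'C[u]%g ->
    {in 'C[u]%g &, forall x c, f (x ^ c)%g = f x} ->
  \sum_(h in Gtilde m u) f (h ^+ m)%g =
  \sum_(y in Gtilde_pow m u reps) (Gamma m u y)%:R * f y.
Proof.
move=> repsP fJ.
pose r h := transversal_repr 1%g reps ((h ^+ m) ^: 'C[u])%g.
have rP h y : h \in Gtilde m u ->
    (r h == y) = (y \in reps) && (h ^+ m \in y ^: 'C[u])%g.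
  move=> /Gtilde_expg_cent/mem_classes hcl.
  rewrite class_sym -in_setI (setI_transversal_pblock repsP 1%g hcl).
  by rewrite inE eq_sym.
rewrite (partition_big r (mem (Gtilde_pow m u reps))) /= => [|h hG]; last first.
  have := rP h (r h) hG; rewrite eqxx => /esym/andP[rh hr].
  by rewrite inE rh; apply/existsP; exists h; rewrite hG.
apply: eq_bigr => y; rewrite inE => /andP[yR _].
have yC := subsetP (transversal_sub repsP) y yR.
rewrite /Gamma -sum1_card natr_sum mulr_suml; apply: eq_big => [h | h /andP[hG]].
  by rewrite inE; case: (boolP (h \in _)) => hG; [rewrite rP // yR | ];
    rewrite inE in hG; rewrite ?hG ?(negPf hG).
by rewrite rP // => /andP[_ /imsetP[c cC ->]]; rewrite fJ // mul1r.
Qed.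

(** * The indicator *)

Section Indicator.
Variables (F : fieldType) (gT : finGroupType) (u : gT) (n : nat).
Variable V : mx_representation F 'C[u]%g n.
Hypothesis G_neq0 : #|gT|%:R != 0 :> F.

Let C_neq0 : #|'C[u]%g|%:R != 0 :> F.
Proof.
have /dvdnP[k kE] : (#|'C[u]%g| %| #|gT|)%N by rewrite -cardsT cardSg ?subsetT.
by apply: contraNneq G_neq0 => C0; rewrite kE natrM C0 mulr0.
Qed.

Lemma modchar_is_linear (A : algType F) (M : algModule A) :
  linear (modchar M : A -> F^o).
Proof.
case: M => W act lin_act ? ? k a b; rewrite /modchar /lftrace /= lin_act.
by rewrite !linearP.
Qed.
HB.instance Definition _ A (M : algModule A) :=
  GRing.isSemilinear.Build F A F^o _ (modchar M : A -> F^o)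
    (GRing.semilinear_linear (modchar_is_linear M)).

(** The integral contributes, for each [x], the terms [p_k >< x ^+ m] with
    [(k * x^-1) ^+ m * x ^+ m = 1]. Against the summand of the character at [y]
    only [k = u ^ y^-1] counts, and with [x = h^-1 ^ y^-1] the condition becomes
    [(u * h) ^+ m = h ^+ m], free of [y]; the sum over [y] cancels the order of
    the group. *)
Lemma FSindicator_induced m :
  FSindicator m (modchar (induced_module V)) =
  (#|'C[u]%g|%:R)^-1 * \sum_(h in Gtilde m u) \tr (V (h ^+ m)%g).
Proof.
(* The powers that come out below are [h ^- m]. *)
rewrite -[in RHS](sum_Gtilde_inv m u (fun g => \tr (V g))).
rewrite /FSindicator ddLambda_powE linearZ linear_sum.
have -> : \sum_x modchar (induced_module V)
      (\sum_(k | ((k * x^-1) ^+ m * x ^+ m)%g == 1%g) dd F k (x ^+ m)%g) =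
    (#|'C[u]%g|%:R)^-1 * \sum_x \sum_y
      (if (((u ^ y^-1 * x^-1) ^+ m * x ^+ m)%g == 1%g)
        && ((x ^+ m) ^ y \in 'C[u])%g then \tr (V ((x ^+ m) ^ y)%g) else 0).
  rewrite mulr_sumr; apply: eq_bigr => x _; rewrite linear_sum /=.
  under eq_bigr => k _ do rewrite modchar_induced_dd // big_mkcond.
  rewrite -mulr_sumr exchange_big; congr (_ * _); apply: eq_bigr => y _ /=.
  rewrite big_mkcond (bigD1 (u ^ y^-1)%g) //= eqxx big1 ?addr0.
    by case: ifP.
  by move=> k /negPf ->; case: ifP.
rewrite exchange_big /=.
rewrite (eq_bigr (fun=> \sum_(h in Gtilde m u) \tr (V (h ^- m)%g))) => [|y _].
  set S := \sum_(h in _) _; have -> : \sum_(y : gT) S = #|gT|%:R * S.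
    by rewrite sumr_const mulr_natl.
  by rewrite [LHS]mulrCA; congr (_ * _); apply: mulKf.
(* Substitute [x = h^-1 ^ y^-1]. *)
rewrite (reindex_inj (inj_comp (conjg_inj y^-1%g) invg_inj)) [RHS]big_mkcond.
apply: eq_bigr => h _ /=.
rewrite -conjVg invgK -conjMg -!conjXg -conjMg conjgKV conjg_eq1.
rewrite expgVn -eq_mulgV1.
have -> : ((u * h) ^+ m == h ^+ m)%g = (h \in Gtilde m u) by rewrite inE.
by case: (boolP (h \in Gtilde m u)) => //= /Gtilde_expg_cent hC; rewrite groupV hC.
Qed.

End Indicator.

Theorem proposition3p1p6 (R : realType) (gT : finGroupType) (u : gT)
    (n : nat) (V : mx_representation R[i] 'C[u]%g n)
    (irrV : mx_irreducible V)
    (reps : {set gT})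
    (repsP : is_transversal reps (classes 'C[u]%g) 'C[u]%g)
    (m : nat) (m_ge1 : (1 <= m)%N) :
  FSindicator m (modchar (induced_module V)) =
    (#|'C[u]%g|%:R)^-1 *
    \sum_(y in Gtilde_pow m u reps) (Gamma m u y)%:R * \tr (V y).
Proof.
have G_neq0 : #|gT|%:R != 0 :> R[i].
  by rewrite pnatr_eq0 -lt0n; apply/card_gt0P; exists 1%g.
rewrite FSindicator_induced //; congr (_ * _).
apply: (sum_Gtilde_classes m (f := fun g => \tr (V g)) repsP) => x c xC cC /=.
rewrite conjgE !repr_mxM ?groupM ?groupV // mxtrace_mulC -mulmxA.
by rewrite -repr_mxM ?groupV // mulgV repr_mx1 mulmx1.
Qed.
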